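(* Let $a,b\in\mathbb{Q}$, $a>-1$, $b>0$. For $n=0,1,2,\ldots$ let $$p_n(a,b)=\sum_{k=0}^n\binom{n}{k}^2(a+1)_{n+k}\,b^{n-k}H_{n+k}(a)-2\sum_{k=1}^n\sum_{m=0}^k\sum_{l=0}^{n-k}\frac{(-1)^{m+k}}{k}\binom{n}{k+l}\binom{k}{m}\binom{n-k}{l}(a+1)_{m+n+l}\,b^{n-m-l}.$$ Then for every $n\ge0$ $$p_n(a,b)=\sum_{k=0}^n\binom{n}{k}^2(a+1)_{n+k}\,b^{n-k}\bigl(H_{n+k}(a)+2H_{n-k}-2H_k\bigr).$$
   Context: $(a)_0=1$ and $(a)_m=a(a+1)\cdots(a+m-1)$ for $m\ge1$ is the Pochhammer symbol. The (shifted) harmonic numbers are $H_0(\alpha)=0$, $H_m(\alpha)=\sum_{k=1}^m\frac{1}{k+\alpha}$ for $m\ge1$, and $H_m=H_m(0)$. *)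

(* Defs.v *)
From mathcomp Require Import all_boot all_order all_algebra.

Set Implicit Arguments.
Unset Strict Implicit.
Unset Printing Implicit Defensive.

Import Order.TTheory GRing.Theory Num.Theory.
Local Open Scope ring_scope.

Definition pochhammer (a : rat) (m : nat) : rat :=
  \prod_(0 <= i < m) (a + i%:R).

Definition harmonic_shift (alpha : rat) (m : nat) : rat :=
  \sum_(1 <= k < m.+1) 1 / (k%:R + alpha).

Definition harmonic (m : nat) : rat := harmonic_shift 0 m.

(* The subtractions in the exponents and binomials are on nat, but never
   truncate: k <= n in both sums, and m <= k, l <= n - k give m + l <= n. *)
Definition p (n : nat) (a b : rat) : rat :=
  \sum_(0 <= k < n.+1)
     'C(n, k)%:R ^+ 2 * pochhammer (a + 1) (n + k) * b ^+ (n - k)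
       * harmonic_shift a (n + k)
  - 2%:R * \sum_(1 <= k < n.+1) \sum_(0 <= m < k.+1) \sum_(0 <= l < (n - k).+1)
     (-1) ^+ (m + k) / k%:R * 'C(n, k + l)%:R * 'C(k, m)%:R * 'C(n - k, l)%:R
       * pochhammer (a + 1) (m + n + l) * b ^+ (n - m - l).

(* Main.v *)
Require Import Defs.
From mathcomp Require Import all_boot all_order all_algebra.
From mathcomp Require Import zify ring.

Import Order.TTheory GRing.Theory Num.Theory.
Local Open Scope ring_scope.

(** The terms with H_{n+k}(a) occur on both sides, so the claim is about the
triple sum alone. Its weight (a+1)_{n+m+l} b^{n-m-l} depends only on
s = m + l; put j = k - m. Then the sign (-1)^(m+k) is (-1)^j, the binomials
become C(n, s+j) C(k, j) C(n-k, n-s-j), and these vanish by themselves outside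
the original range, so s and j may run independently over 0..n. This is
[double_sum_reindex]. It remains to see that the coefficient of the s-th
weight,

  sum_j (-1)^j C(n, s+j) T_j,   T_j = sum_{k=1}^n C(k, j) C(n-k, n-s-j) / k,

is C(n, s)^2 (H_s - H_{n-s}), which is [coefficient_bin_harmonic].
 - For j >= 1, C(k, j) / k = C(k-1, j-1) / j turns T_j into a convolution of
   binomials, with value C(n, s) / j ([sum_bin_pair_over_index]); summed
   against (-1)^j C(n, s+j), these terms give C(n, s)^2 (H_s - H_n).
 - For j = 0, T_0 = sum_k C(n-k, n-s) / k = C(n, s) (H_n - H_{n-s}), and the
   outer factor is C(n, s).
The two single sums evaluated here, sum_k C(n-k, q) / k and
- sum_j (-1)^j C(n, q+j) / j, are both C(n, q) (H_n - H_q), for the same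
reason: as functions of n and q they obey Pascal's rule and have equal
boundary values ([pascal_harmonicE]). *)

Lemma harmonicS n : harmonic n.+1 = harmonic n + n.+1%:R^-1.
Proof. by rewrite /harmonic /harmonic_shift big_nat_recr //= addr0 div1r. Qed.

Lemma bin_absorb n k :
  'C(n, k)%:R / k.+1%:R = 'C(n.+1, k.+1)%:R / n.+1%:R :> rat.
Proof.
have /(congr1 (fun x => x%:R : rat)) := mul_bin_diag n.+1 k.
rewrite !natrM /= => E.
by apply/eqP; rewrite eqr_div ?pnatr_eq0 // mulrC E mulrC.
Qed.

Lemma sum_alternating_bin n :
  \sum_(0 <= i < n.+2) (-1) ^+ i * 'C(n.+1, i)%:R = 0 :> rat.
Proof.
transitivity ((1 - 1) ^+ n.+1 : rat); last by rewrite subrr expr0n.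
rewrite exprDn big_mkord; apply: eq_bigr => i _.
by rewrite expr1n mul1r mulr_natr.
Qed.

(** Pascal's rule and the values on the boundary determine a function on pairs
of naturals. That C(n, q) (H_n - H_q) obeys the rule is the cancellation of
C(n+1, q+1) / (n+1) against C(n, q) / (q+1), two expressions for the same
number; these are the errors made by replacing H_{n+1} by H_n and H_{q+1}
by H_q. *)
Lemma pascal_harmonicE (f : nat -> nat -> rat) :
    (forall q, f 0 q = 0) ->
    (forall n, f n.+1 0 = f n 0 + n.+1%:R^-1) ->
    (forall n q, f n.+1 q.+1 = f n q + f n q.+1) ->
  forall n q, f n q = 'C(n, q)%:R * (harmonic n - harmonic q).
Proof.
move=> f0 fS0 fSS; elim=> [|n IHn] [|q].
- by rewrite f0 subrr mulr0.
- by rewrite f0 bin0n mul0r.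
- by rewrite fS0 IHn !bin0 harmonicS; ring.
rewrite fSS !IHn !harmonicS.
have := bin_absorb n q; rewrite binS natrD => E.
have -> : ('C(n, q.+1)%:R + 'C(n, q)%:R) *
   (harmonic n + n.+1%:R^-1 - (harmonic q + q.+1%:R^-1)) =
  ('C(n, q.+1)%:R + 'C(n, q)%:R) *
   (harmonic n - (harmonic q + q.+1%:R^-1)) +
   ('C(n, q.+1)%:R + 'C(n, q)%:R) / n.+1%:R by ring.
by rewrite -E; ring.
Qed.

Lemma sum_bin_over_index n q :
  \sum_(1 <= k < n.+1) 'C(n - k, q)%:R / k%:R =
  'C(n, q)%:R * (harmonic n - harmonic q) :> rat.
Proof.
move: n q; apply: pascal_harmonicE => [q|n|n q].
- by rewrite big_geq.
- rewrite big_nat_recr //= bin0 div1r; congr (_ + _).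
  by apply: eq_bigr => k _; rewrite !bin0.
rewrite big_nat_recr //= subnn bin0n mul0r addr0 -big_split /=.
apply: eq_big_nat => k /andP[_ lekn].
by rewrite subSn // binS natrD; ring.
Qed.

(** The negated sum is the one that fits [pascal_harmonicE]. On the boundary
q = 0, raising n to n+1 adds sum_j (-1)^j C(n, j-1) / j to the sum on the left,
which by absorption is sum_{j>=1} (-1)^j C(n+1, j) / (n+1) = - 1 / (n+1), the
full alternating sum of a row of Pascal's triangle being 0. *)
Lemma alternating_sum_bin_over_index n q :
  \sum_(1 <= j < n.+1) (-1) ^+ j * 'C(n, q + j)%:R / j%:R =
  'C(n, q)%:R * (harmonic q - harmonic n) :> rat.
Proof.
rewrite -[LHS]opprK -[harmonic q - _]opprB mulrN; congr (- _).
move: n q; apply: pascal_harmonicE => [q|n|n q].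
- by rewrite big_geq ?oppr0.
- rewrite (eq_big_nat _ _ (F2 := fun j => (-1) ^+ j * 'C(n, 0 + j)%:R / j%:R
      + (-1) ^+ j * 'C(n.+1, j)%:R / n.+1%:R)); last first.
    case=> // j _; rewrite !add0n -[_ / n.+1%:R]mulrA -bin_absorb.
    by rewrite binS natrD; ring.
  rewrite big_split /= big_nat_recr //= add0n bin_small // mulr0 mul0r addr0.
  rewrite -mulr_suml opprD; congr (_ + _).
  have := sum_alternating_bin n; rewrite big_nat_recl // big_add1 /= bin0.
  rewrite expr0 mul1r => /eqP; rewrite addrC addr_eq0 => /eqP ->.
  by rewrite mulN1r opprK.
rewrite -opprD; congr (- _).
rewrite (eq_big_nat _ _ (F2 := fun j => (-1) ^+ j * 'C(n, q + j)%:R / j%:R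
      + (-1) ^+ j * 'C(n, q.+1 + j)%:R / j%:R)); last first.
  by move=> j _; rewrite addSn binS natrD; ring.
(* The ranges differ only in the top index, where the binomials vanish. *)
rewrite big_split /=; congr (_ + _);
  rewrite big_nat_recr //= bin_small; try lia.
  by rewrite mulr0 mul0r addr0.
by rewrite mulr0 mul0r addr0.
Qed.

(** Sorting the (i+j+1)-subsets of an (n+1)-set by their (i+1)-st smallest
element, at position k, gives the summand: i elements lie below it and j
above. The proof is by Pascal's rule in n. *)
Lemma sum_bin_convolution n i j :
  (\sum_(0 <= k < n.+1) 'C(k, i) * 'C(n - k, j) = 'C(n.+1, (i + j).+1))%N.
Proof.
elim: n j => [|n IHn] j.
  by rewrite big_nat1 binS !bin0n; case: i j => [|i] [|j].
case: j => [|j]; rewrite big_nat_recr //= subnn !bin0n.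
  rewrite addn0 muln1 [RHS]binS -[in 'C(n.+1, i.+1)](addn0 i) -IHn.
  congr (_ + _)%N.
  by apply: eq_bigr => k _; rewrite !bin0.
rewrite muln0 addn0 addnS [RHS]binS -[in X in (X + _)%N]addnS -!IHn.
rewrite -big_split /=.
apply: eq_big_nat => k /andP[_ lekn].
by rewrite subSn // binS mulnDr.
Qed.

Lemma sum_bin_pair_over_index n s j : (s + j.+1 <= n)%N ->
  \sum_(1 <= k < n.+1) 'C(k, j.+1)%:R * 'C(n - k, n - s - j.+1)%:R / k%:R =
  'C(n, s)%:R / j.+1%:R :> rat.
Proof.
case: n => [|n] le_sj; first by rewrite addnS in le_sj.
rewrite big_add1 /=.
rewrite -(bin_sub (n := n.+1) (m := s)); last by lia.
have -> : (n.+1 - s = (j + (n.+1 - s - j.+1)).+1)%N by lia.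
rewrite -sum_bin_convolution natr_sum mulr_suml.
apply: eq_big_nat => k _; rewrite natrM subSS.
have -> : ((j + (n.+1 - s - j.+1)).+1 - j.+1 = n.+1 - s - j.+1)%N by lia.
by rewrite mulrAC -bin_absorb; ring.
Qed.

(** The term j = 0 contributes H_n - H_{n-s} and the terms j >= 1 contribute
H_s - H_n, each with the factor C(n, s)^2. *)
Lemma coefficient_bin_harmonic n s : (s <= n)%N ->
  \sum_(0 <= j < n.+1) (-1) ^+ j * 'C(n, s + j)%:R
     * (\sum_(1 <= k < n.+1) 'C(k, j)%:R * 'C(n - k, n - s - j)%:R / k%:R) =
  'C(n, s)%:R ^+ 2 * (harmonic s - harmonic (n - s)) :> rat.
Proof.
move=> le_sn; rewrite big_ltn // addn0 subn0 expr0 mul1r.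
under [X in _ * X + _]eq_bigr do rewrite bin0 mul1r.
rewrite sum_bin_over_index bin_sub //.
rewrite (eq_big_nat _ _ (F2 := fun j =>
    (-1) ^+ j * 'C(n, s + j)%:R / j%:R * 'C(n, s)%:R)); last first.
  case=> // j _; have [le_sj|gt_sj] := leqP (s + j.+1) n.
    by rewrite sum_bin_pair_over_index //; ring.
  by rewrite bin_small // !(mulr0, mul0r).
by rewrite -mulr_suml alternating_sum_bin_over_index; ring.
Qed.

(** The substitution is s = m + l and j = k - m. For fixed j <= k, the index
l in 0..n-k corresponds to s in k-j..n-j. Below this interval C(n-k, n-s-j)
vanishes, above it C(n, s+j) does, and C(k, j) vanishes for j > k; hence the
bounds on the right do not depend on k, and the sum over k can be moved
inside. *)
Lemma double_sum_reindex (w : nat -> rat) n k : (k <= n)%N ->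
  \sum_(0 <= m < k.+1) \sum_(0 <= l < (n - k).+1)
     (-1) ^+ (m + k) * 'C(n, k + l)%:R * 'C(k, m)%:R * 'C(n - k, l)%:R
       * w (m + l)%N =
  \sum_(0 <= s < n.+1) \sum_(0 <= j < n.+1)
     (-1) ^+ j * 'C(n, s + j)%:R * 'C(k, j)%:R * 'C(n - k, n - s - j)%:R * w s.
Proof.
move=> le_kn; rewrite [RHS]exchange_big_nat /=.
rewrite [RHS](@big_cat_nat _ _ _ k.+1) //=.
rewrite [X in _ + X]big_nat_cond [X in _ + X]big1 ?addr0; last first.
  move=> j /andP[/andP[lt_kj _] _]; apply: big1 => s _.
  by rewrite (@bin_small k j) // !(mulr0, mul0r).
rewrite big_nat_rev /=; apply: eq_big_nat => j /andP[_ le_jk].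
rewrite add0n subSS.
rewrite [RHS](@big_cat_nat _ _ _ (k - j)%N) //=; last by lia.
rewrite [X in X + _]big_nat_cond [X in X + _]big1 ?add0r; last first.
  move=> s /andP[/andP[_ lt_s] _].
  by rewrite (@bin_small (n - k)) ?(mulr0, mul0r) //; lia.
rewrite [RHS](@big_cat_nat _ _ _ (n - j).+1%N) //=; try lia.
rewrite [X in _ + X]big_nat_cond [X in _ + X]big1 ?addr0; last first.
  move=> s /andP[/andP[gt_s _] _].
  by rewrite (@bin_small n) ?(mulr0, mul0r) //; lia.
rewrite [RHS](@big_addn _ _ _ 0 (n - j).+1 (k - j)).
have -> : ((n - j).+1 - (k - j) = (n - k).+1)%N by lia.
apply: eq_big_nat => l /andP[_ le_l].
have -> : (l + (k - j) + j = k + l)%N by lia.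
have -> : (n - (l + (k - j)) - j = n - k - l)%N by lia.
(* C(k, k-j) and C(n-k, n-k-l) are replaced by their mirror images. *)
rewrite bin_sub // bin_sub // [(l + _)%N]addnC.
have -> : (k - j + k = j + (k - j).*2)%N by lia.
by rewrite exprD -mul2n exprM sqrrN !expr1n mulr1.
Qed.

Lemma triple_sum_coefficients (w : nat -> rat) n :
  \sum_(1 <= k < n.+1) \sum_(0 <= m < k.+1) \sum_(0 <= l < (n - k).+1)
     (-1) ^+ (m + k) / k%:R * 'C(n, k + l)%:R * 'C(k, m)%:R * 'C(n - k, l)%:R
       * w (m + l)%N =
  \sum_(0 <= s < n.+1)
     'C(n, s)%:R ^+ 2 * w s * (harmonic s - harmonic (n - s)).
Proof.
transitivity (\sum_(1 <= k < n.+1) \sum_(0 <= s < n.+1) \sum_(0 <= j < n.+1)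
   (-1) ^+ j * 'C(n, s + j)%:R * 'C(k, j)%:R * 'C(n - k, n - s - j)%:R * w s
     / k%:R).
  apply: eq_big_nat => k /andP[_ le_kn].
  under [RHS]eq_bigr do rewrite -mulr_suml.
  rewrite -mulr_suml -double_sum_reindex // mulr_suml.
  apply: eq_bigr => m _; rewrite mulr_suml; apply: eq_bigr => l _; ring.
rewrite exchange_big_nat; apply: eq_big_nat => s /andP[_ le_sn] /=.
rewrite mulrAC -coefficient_bin_harmonic // exchange_big_nat /= mulr_suml.
apply: eq_bigr => j _; rewrite mulr_sumr mulr_suml.
by apply: eq_bigr => k _; ring.
Qed.

Theorem theorem2 (a b : rat) (ha : -1 < a) (hb : 0 < b) (n : nat) :
  p n a b =
  \sum_(0 <= k < n.+1)
     'C(n, k)%:R ^+ 2 * pochhammer (a + 1) (n + k) * b ^+ (n - k)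
       * (harmonic_shift a (n + k) + 2%:R * harmonic (n - k)
          - 2%:R * harmonic k).
Proof.
pose w s := pochhammer (a + 1) (n + s) * b ^+ (n - s).
rewrite /p; under [X in _ - _ * X]eq_bigr => k _ do
  under eq_bigr => m _ do under eq_bigr => l _ do
    rewrite -mulrA [(m + n)%N]addnC -addnA -subnDA -/(w (m + l)%N).
rewrite triple_sum_coefficients mulr_sumr -sumrB.
by apply: eq_bigr => k _; rewrite /w; ring.
Qed.
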